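(* Let $d\ge 2$, $m\ge 0$ and $n\ge 1$ be integers and let $f=f_{d,c}(z)=z^d+c$. Define $$G_d(m,n)=\begin{cases}\dfrac{\Phi^{\ast}_{f,m,n}(0)}{\Phi^{\ast}_{f,0,n}(0)^{d-1}} & \text{if } m\neq 0 \text{ and } n\mid (m-1),\\[2mm] \Phi^{\ast}_{f,m,n}(0) & \text{otherwise.}\end{cases}$$ Then the values $c\in\mathbb{C}$ for which $f_{d,c}$ is post-critically finite with $0$ having exact period $(m,n)$ under $f_{d,c}$ are exactly the roots of $G_d(m,n)$ (viewed as a polynomial in $c$). Moreover, all of the roots of $G_d(m,n)$ as a polynomial in $c$ are simple.
   Context: $f^n$ denotes the $n$-th iterate, $f^0(z)=z$. A polynomial is post-critically finite (PCF) if the forward orbits of all its (affine) critical points are finite; the only affine critical point of $f_{d,c}$ is $0$. A point $z_0$ has period $(m,n)$ for $f$ if $f^{m+n}(z_0)=f^m(z_0)$; it has exact period $(m,n)$ if in addition it does not have period $(k,t)$ for any $k\le m$ and $t\mid n$ with at least one of $k<m$ or $t<n$. Let $\mu$ be the Möbius function. The dynatomic polynomial is $\Phi^{\ast}_{f,n}(z)=\prod_{k\mid n}\left(f^k(z)-z\right)^{\mu(n/k)}$. The generalized dynatomic polynomial is $\Phi^{\ast}_{f,0,n}=\Phi^{\ast}_{f,n}$ and, for $m\ge 1$, $$\Phi^{\ast}_{f,m,n}(z)=\frac{\Phi^{\ast}_{f,n}(f^m(z))}{\Phi^{\ast}_{f,n}(f^{m-1}(z))}.$$ Here $c$ is treated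 as an indeterminate when forming these expressions, so $\Phi^{\ast}_{f,m,n}(0)$ is an expression in $c$. *)

(* Defs.v *)
From HB Require Import structures.
From mathcomp Require Import all_boot all_order all_algebra.
From mathcomp Require Import classical_sets cardinality reals.
From mathcomp Require Export complex.

Set Implicit Arguments.
Unset Strict Implicit.
Unset Printing Implicit Defensive.

Import GRing.Theory.
Local Open Scope ring_scope.

Definition moebius (n : nat) : int :=
  if all (fun p => logn p n == 1%N) (primes n)
  then (-1) ^+ size (primes n) else 0.

Definition unicritical (A : nzRingType) (d : nat) (c : A) : {poly A} :=
  'X^d + c%:P.

Definition iterate (A : nzRingType) (f : {poly A}) (n : nat) (z : A) : A :=
  iter n (horner f) z.

Definition has_period (A : nzRingType) (f : {poly A}) (m n : nat) (z : A) :=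
  iterate f (m + n) z = iterate f m z.

Definition exact_period (A : nzRingType) (f : {poly A}) (m n : nat) (z : A) :=
  has_period f m n z /\
  forall k t : nat, (k <= m)%N -> (t %| n)%N -> (k < m)%N || (t < n)%N ->
    ~ has_period f k t z.

Definition PCF (F : fieldType) (f : {poly F}) : Prop :=
  forall z : F, root f^`() z -> finite_set (range (fun n => iterate f n z)).

(* The values at z of the dynatomic and generalized dynatomic polynomials,
   computed from their defining products and quotients.  Since x^-1 = 0 for
   x = 0, these are the values of the polynomials only at points z where no
   denominator vanishes (see dynatomic_horner).  They are used only at z = 0
   over C(c), where nothing vanishes when d >= 2: see
   dynatomic_factor_orbit0_neq0 and dynatomic_orbit0_neq0. *)
Definition dynatomic (K : fieldType) (f : {poly K}) (n : nat) (z : K) : K :=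
  \prod_(k <- divisors n) (iterate f k z - z) ^ moebius (n %/ k).

Definition gdynatomic (K : fieldType) (f : {poly K}) (m n : nat) (z : K) : K :=
  if m is m'.+1
  then dynatomic f n (iterate f m z) / dynatomic f n (iterate f m' z)
  else dynatomic f n z.

(* z^d + c over the field F(c), with c an indeterminate. *)
Definition generic_unicritical (F : fieldType) (d : nat) :
    {poly {fraction {poly F}}} :=
  unicritical d (FracField.tofrac 'X).

Definition G (F : fieldType) (d m n : nat) : {fraction {poly F}} :=
  let f := generic_unicritical F d in
  if (m != 0%N) && (n %| m - 1)%N
  then gdynatomic f m n 0 / gdynatomic f 0 n 0 ^+ (d - 1)
  else gdynatomic f m n 0.

Lemma unicritical_horner (A : nzRingType) (d : nat) (c z : A) :
  (unicritical d c).[z] = z ^+ d + c.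
Proof. by rewrite /unicritical hornerD hornerXn hornerC. Qed.

Lemma size_iterate_unicritical0 (F : fieldType) (d k : nat) :
  (2 <= d)%N ->
  size (iterate (unicritical d ('X : {poly F})) k.+1 0) = (d ^ k).+1.
Proof.
move=> d2; elim: k => [|k IH].
  by rewrite /= unicritical_horner expr0n gtn_eqF ?(ltnW d2) // add0r size_polyX.
rewrite /iterate iterS -/(iterate _ _ _) unicritical_horner.
have s : size (iterate (unicritical d ('X : {poly F})) k.+1 0 ^+ d)
         = (d ^ k.+1).+1.
  by rewrite polySpred ?size_exp ?IH ?expnSr // expf_neq0 // -size_poly_gt0 IH.
rewrite size_polyDl s // size_polyX ltnS.
by rewrite (leq_trans d2) // -{1}(expn1 d) leq_pexp2l // ltnW.
Qed.

Lemma iterate_unicritical0_inj (F : fieldType) (d : nat) :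
  (2 <= d)%N ->
  injective (fun k => iterate (unicritical d ('X : {poly F})) k 0).
Proof.
move=> d2 [|i] [|j] // /(congr1 (fun p : {poly F} => size p)).
- by rewrite size_iterate_unicritical0 // /iterate /= size_poly0.
- by rewrite size_iterate_unicritical0 // /iterate /= size_poly0.
- by rewrite !size_iterate_unicritical0 // => -[] /(expnI d2) ->.
Qed.

Lemma iterate_generic0 (F : fieldType) (d k : nat) :
  iterate (generic_unicritical F d) k 0 =
  FracField.tofrac (iterate (unicritical d ('X : {poly F})) k 0).
Proof.
elim: k => [|k IH]; first by rewrite /iterate /= tofrac0.
rewrite /iterate !iterS -!/(iterate _ _ _) IH /generic_unicritical.
by rewrite !unicritical_horner tofracD tofracXn.
Qed.

Lemma dynatomic_factor_orbit0_neq0 (F : fieldType) (d k m : nat) :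
  (2 <= d)%N -> (0 < k)%N ->
  let f := generic_unicritical F d in
  iterate f k (iterate f m 0) - iterate f m 0 != 0.
Proof.
move=> d2 k0 /=; rewrite subr_eq0.
have -> : iterate (generic_unicritical F d) k
            (iterate (generic_unicritical F d) m 0)
          = iterate (generic_unicritical F d) (k + m) 0.
  by rewrite /iterate iterD.
rewrite !iterate_generic0 tofrac_eq.
apply/eqP => /(iterate_unicritical0_inj d2) /eqP.
by rewrite -{2}[m]add0n eqn_add2r eqn0Ngt k0.
Qed.

Lemma dynatomic_orbit0_neq0 (F : fieldType) (d m n : nat) :
  (2 <= d)%N -> (1 <= n)%N ->
  let f := generic_unicritical F d in dynatomic f n (iterate f m 0) != 0.
Proof.
move=> d2 n1 /=; rewrite /dynatomic big_seq prodf_seq_neq0.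
apply/allP => k kn; apply/implyP => _; apply: expfz_neq0.
apply: dynatomic_factor_orbit0_neq0 => //.
by move: kn; rewrite -dvdn_divisors // => /dvdn_gt0; apply.
Qed.

Lemma dynatomic_horner (K : fieldType) (f P : {poly K}) (n : nat) (z : K) :
  (forall k, k \in divisors n -> iterate f k z - z != 0) ->
  FracField.tofrac P = \prod_(k <- divisors n)
     FracField.tofrac (iter k (fun q => f \Po q) 'X - 'X) ^ moebius (n %/ k) ->
  P.[z] = dynatomic f n z.
Proof.
pose q k : {poly K} := iter k (fun q => f \Po q) 'X - 'X.
have qz k : (q k).[z] = iterate f k z - z.
  rewrite /q hornerD hornerN hornerX; congr (_ - _).
  elim: k => [|k IH]; first by rewrite hornerX.
  by rewrite /iterate !iterS horner_comp IH.
move=> nz eP.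
pose pos (e : int) : nat := if e is Posz k then k else 0%N.
pose neg (e : int) : nat := if e is Negz k then k.+1 else 0%N.
have split (L : fieldType) (x : L) (e : int) : x != 0 ->
    x ^ e * x ^+ neg e = x ^+ pos e.
  by case: e => k x0 /=; rewrite ?mulr1 // mulVf ?expf_neq0.
pose N := \prod_(k <- divisors n) q k ^+ neg (moebius (n %/ k)).
pose Q := \prod_(k <- divisors n) q k ^+ pos (moebius (n %/ k)).
have q0 k : k \in divisors n -> q k != 0.
  by move=> kn; apply: contraNneq (nz k kn) => e; rewrite -qz e horner0.
have PN : P * N = Q.
  apply/eqP; rewrite -tofrac_eq tofracM eP.
  rewrite !rmorph_prod -big_split /= big_seq [X in _ == X]big_seq.
  apply/eqP/eq_bigr => k kn.
  by rewrite !rmorphXn split // tofrac_eq0 q0.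
have N0 : N.[z] != 0.
  rewrite horner_prod big_seq prodf_seq_neq0; apply/allP => k kn.
  by apply/implyP => _; rewrite horner_exp expf_neq0 // qz nz.
apply: (mulIf N0); rewrite -hornerM PN !horner_prod -big_split /=.
rewrite big_seq [RHS]big_seq; apply: eq_bigr => k kn.
by rewrite !horner_exp qz split // nz.
Qed.

(* Main.v *)
Require Import Defs.
From mathcomp Require Import all_boot all_order all_algebra.
From mathcomp Require Import ring.
From mathcomp Require Import boolp classical_sets cardinality reals complex.
Set Implicit Arguments.
Unset Strict Implicit.
Unset Printing Implicit Defensive.
Import Order.TTheory GRing.Theory Num.Theory.
Local Open Scope ring_scope.

(** Let P_k be the k-th iterate of 0 under z^d + c, a polynomial in c. Up to the
    correction by the power d - 1, G is a product of powers of the differences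
    P_(m+k) - P_m, so the theorem follows from the order of vanishing of each
    difference at each parameter a. These orders give the divisor of the
    rational function G; it is 1 at the parameters of exact period (m,n) and 0
    elsewhere, and a rational function with an effective divisor is a
    polynomial (effective_divisor).

    If the orbit of 0 at a is infinite, no difference vanishes. Otherwise let s
    be its preperiod and t its period; the difference vanishes at a exactly when
    s <= m and t divides k. Passing from m to m + 1 multiplies the difference
    X - Y by the cofactor of X - Y in X^d - Y^d. That cofactor does not vanish
    where X = Y is nonzero, so from m = s on the order changes only when the
    orbit meets 0.

    If s > 0, the zero appears at m = s and stays of the same order
    (mup_orbit_diff_preperiodic). It is simple: X = P_(s-1+k) and Y = P_(s-1)
    satisfy X = z Y at a for some d-th root of unity z other than 1, and the
    derivatives of X and z Y at a differ (misiurewicz_transversality). This is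
    arithmetic. The parameter a is an algebraic integer and derivatives of
    iterates are congruent to 1 modulo d, so equality would make d divide 1 - z.
    As the product of the 1 - z^i over 0 < i < o is the order o of z, a divisor
    of d, this forces d = 2, z = -1 (unity_root_congr1), where a computation
    modulo 2 gives a contradiction.

    If s = 0, the same congruence shows that P_t has a simple zero at a, and
    every passage through the critical point adds d - 1 to the order
    (mup_orbit_diffS).

    In both cases the order depends on k only through the condition that t
    divides k, so that Moebius inversion (moebius_sum_multiples) retains the
    contribution of t = n alone, and comparing consecutive values of m leaves
    the claimed divisor (G_order_orbit_type). *)

(** * Sums of the Moebius function *)

Lemma moebius_prime_mul (p q : nat) : prime p -> (0 < q)%N -> ~~ (p %| q)%N ->
  moebius (p * q) = - moebius q.
Proof.
move=> pp q0 npq; have p0 := prime_gt0 pp.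
have eqP : perm_eq (primes (p * q)) (p :: primes q).
  apply: uniq_perm; rewrite ?primes_uniq //=.
    by rewrite primes_uniq mem_primes (negPf npq) !andbF.
  by move=> r; rewrite in_cons primesM // primes_prime // inE.
rewrite /moebius (perm_size eqP) (perm_all _ eqP) /= lognM // logn_prime // eqxx.
have -> : logn p q = 0%N by rewrite lognE (negPf npq) !andbF.
rewrite (eq_in_all (a2 := fun r => logn r q == 1%N)) => [|r].
  rewrite addn0 eqxx andTb; case: (all _ _); by rewrite ?oppr0 // exprS mulN1r.
rewrite mem_primes => /and3P[pr _ rq]; rewrite lognM // logn_prime //.
by have /negPf-> : r != p by apply: contraNneq npq => <-.
Qed.

Lemma moebius_square (p q : nat) : prime p -> (0 < q)%N -> (p ^ 2 %| q)%N ->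
  moebius q = 0.
Proof.
move=> pp q0; rewrite pfactor_dvdn // => p2; rewrite /moebius ifF //.
apply/negP => /allP/(_ p); rewrite -logn_gt0 (ltnW p2) => /(_ isT)/eqP l1.
by rewrite l1 in p2.
Qed.

(** With p a prime factor of n, the divisors of n that contribute are those
    with p-adic valuation 0 or 1, and k <-> p k pairs them with opposite
    signs. *)
Lemma moebius_sum (n : nat) : (0 < n)%N ->
  \sum_(k <- divisors n) moebius k = (n == 1%N)%:R.
Proof.
move=> n0; have [->|n1] := eqVneq n 1%N; first by rewrite big_seq1.
have pp : prime (pdiv n) by rewrite pdiv_prime // ltn_neqAle eq_sym n1.
move: (pdiv n) pp (pdiv_dvd n) => p pp pn.
have gt0 k : k \in divisors n -> (0 < k)%N.
  by rewrite -dvdn_divisors // => /dvdn_gt0; apply.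
rewrite (bigID (fun k => p %| k)%N) /= addrC.
rewrite [X in _ + X](bigID (fun k => p ^ 2 %| k)%N) /=.
rewrite big_seq_cond [X in _ + (X + _)]big1_seq => [|k]; last first.
  by case/andP=> /andP[_ p2] /gt0 k0; rewrite (moebius_square pp).
rewrite add0r -[X in _ + X]big_filter.
rewrite [X in _ + X](perm_big
  [seq (p * k)%N | k <- divisors n & ~~ (p %| k)%N]); last first.
  apply: uniq_perm; rewrite ?map_inj_uniq ?filter_uniq ?divisors_uniq //.
    by move=> i j /eqP; rewrite eqn_pmul2l ?prime_gt0 // => /eqP.
  move=> k; apply/idP/mapP => [|[j]].
    rewrite mem_filter -andbA => /and3P[/dvdnP[j ->] npj jn].
    rewrite mulnC in npj jn *; exists j => //.
    move: npj jn; rewrite mem_filter -!dvdn_divisors // expnS expn1.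
    rewrite dvdn_pmul2l ?prime_gt0 // => -> /(dvdn_trans _) -> //.
    by rewrite dvdn_mull.
  rewrite mem_filter => /andP[npj jn ->].
  rewrite mem_filter expnS expn1 dvdn_pmul2l ?prime_gt0 // npj dvdn_mulr //=.
  move: jn; rewrite -!dvdn_divisors // Gauss_dvd ?prime_coprime // pn => ->.
  by [].
rewrite big_map big_filter [X in _ + X]big_seq_cond -big_split /= big1 // => k.
by case/andP=> /gt0 k0 npk; rewrite moebius_prime_mul ?subrr.
Qed.

(** The Moebius exponents of the dynatomic polynomial kill every period t but
    n: a factor of index k vanishes only when t divides k. *)
Lemma moebius_sum_multiples (n t : nat) : (0 < n)%N -> (0 < t)%N ->
  \sum_(k <- divisors n) moebius (n %/ k) * (t %| k)%:R = (t == n)%:R.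
Proof.
move=> n0 t0; have [tn|ntn] := boolP (t %| n)%N; last first.
  rewrite big1_seq => [|k /andP[_]].
    by case: eqP ntn => // ->; rewrite dvdnn.
  rewrite -dvdn_divisors // => kn; case: (boolP (t %| k)%N); rewrite ?mulr0 //.
  by move/dvdn_trans=> /(_ _ kn) tn; rewrite tn in ntn.
have nt0 : (0 < n %/ t)%N by rewrite divn_gt0 // dvdn_leq.
under eq_bigr do rewrite mulr_natr mulrb.
rewrite -big_mkcond -[LHS]big_filter.
rewrite (perm_big [seq (n %/ j)%N | j <- divisors (n %/ t)]) /=; last first.
  apply: uniq_perm; rewrite ?filter_uniq ?divisors_uniq //.
    rewrite map_inj_in_uniq ?divisors_uniq // => i j.
    rewrite -!dvdn_divisors // => di dj eqij.
    have {di dj} [di dj] : (i %| n /\ j %| n)%N.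
      by split; [apply: dvdn_trans di _ | apply: dvdn_trans dj _]; apply: dvdn_div.
    apply/eqP; rewrite -(eqn_pmul2l (m := n %/ i)) ?divn_gt0 ?(dvdn_leq n0) //.
      by rewrite divnK // eqij divnK.
    by apply: dvdn_gt0 di.
  move=> k; rewrite mem_filter -dvdn_divisors //; apply/idP/mapP.
    case/andP=> tk kn; exists (n %/ k)%N; last by rewrite divnA ?mulKn.
    rewrite -dvdn_divisors // dvdn_divRL //.
    case/dvdnP: tk kn => a -> kn; rewrite -[X in (_ %| X)%N](divnK kn).
    by rewrite dvdn_pmul2l ?dvdn_mull // divn_gt0 ?(dvdn_leq n0) ?(dvdn_gt0 n0).
  case=> j; rewrite -dvdn_divisors // => dj ->.
  have jn : (j %| n)%N by apply: dvdn_trans dj (dvdn_div _).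
  rewrite dvdn_div // andbT.
  case/dvdnP: dj => a e; rewrite -(divnK tn) e.
  rewrite -mulnA mulnC -mulnA mulKn ?dvdn_mulr //.
  exact: dvdn_gt0 jn.
have -> : (t == n) = (n %/ t == 1)%N.
  by rewrite -[in LHS](divnK tn) -{1}[t]mul1n eqn_pmul2r // eq_sym.
rewrite big_map.
rewrite -moebius_sum // big_seq [RHS]big_seq; apply: eq_bigr => k.
rewrite -dvdn_divisors // => dk; have kn : (k %| n)%N.
  exact: dvdn_trans dk (dvdn_div _).
by rewrite divnA // mulKn.
Qed.

(** * Preperiod and period of an orbit *)

(** The orbit of x is finite with preperiod s and minimal period t, in the
    form in which it is used: as the set of all its coincidences. *)
Definition orbit_type (T : eqType) (f : T -> T) (x : T) (s t : nat) : Prop :=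
  (0 < t)%N /\ forall m k, (0 < k)%N ->
    (iter (m + k) f x == iter m f x) = (s <= m)%N && (t %| k)%N.

Lemma iter_periodM (T : Type) (f : T -> T) x m k j :
  iter (m + k) f x = iter m f x -> iter (m + j * k) f x = iter m f x.
Proof.
move=> e; elim: j => [|j IH]; first by rewrite addn0.
by rewrite mulSn addnCA iterD IH -iterD addnC.
Qed.

Lemma iter_period_le (T : Type) (f : T -> T) x m k l : (m <= l)%N ->
  iter (m + k) f x = iter m f x -> iter (l + k) f x = iter l f x.
Proof. by move=> /subnK <- e; rewrite -addnA !(iterD (l - m)) e. Qed.

Lemma orbit_type_exists (T : eqType) (f : T -> T) (x : T) :
  (forall m k, (0 < k)%N -> iter (m + k) f x != iter m f x) \/
  exists s t, orbit_type f x s t.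
Proof.
pose per m k := (0 < k)%N && (iter (m + k) f x == iter m f x).
have [[m0 [k0 per0]]|nper] := EM (exists m k, per m k); last first.
  left=> m k k0; apply/negP => e; apply: nper; exists m, k; exact/andP.
right; have exs : exists m, `[< exists k, per m k >].
  by exists m0; apply/asboolP; exists k0.
case: (ex_minnP exs) => s /asboolP ext mins.
case: (ex_minnP ext) => t /andP[t0 /eqP st] mint; exists s, t; split=> // m k kgt0.
apply/eqP/andP => [mk|[sm /dvdnP[j ->]]]; last first.
  by apply: iter_period_le sm _; apply: iter_periodM.
have sm : (s <= m)%N.
  by apply: mins; apply/asboolP; exists k; rewrite /per kgt0 mk /=.
split=> //; rewrite /dvdn; apply: contraT; rewrite -lt0n => r0.
(* moving far enough along the cycle and back transports the period k to s *)
have {mk} sk : iter (s + k) f x = iter s f x.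
  have le : (m <= s + m * t)%N.
    by rewrite (leq_trans (leq_pmulr m t0)) ?leq_addl.
  rewrite -[RHS](iter_periodM m st) -(iter_period_le le mk).
  by rewrite addnC iterD [in RHS]addnC [in RHS]iterD iter_periodM.
have : (t <= k %% t)%N; last by rewrite leqNgt ltn_mod t0.
apply: mint; rewrite /per r0 /=; apply/eqP.
rewrite -[RHS]sk [in RHS](divn_eq k t) addnA addnC iterD.
by rewrite [in RHS]addnC [in RHS]iterD iter_periodM.
Qed.

Lemma exact_periodP (A : nzRingType) (f : {poly A}) (z : A) (s t m n : nat) :
  orbit_type (horner f) z s t -> (0 < n)%N ->
  exact_period f m n z <-> s = m /\ t = n.
Proof.
move=> [t0 type] n0; have perP i k : (0 < k)%N ->
    has_period f i k z <-> (s <= i)%N && (t %| k)%N.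
  by move=> k0; rewrite -type //; split=> /eqP.
split=> [[/perP-/(_ n0)/andP[sm tn] min]|[<- <-]].
  have : ~~ ((s < m) || (t < n))%N.
    by apply/negP => /(min s t sm tn); apply; apply/perP; rewrite ?leqnn ?dvdnn.
  rewrite negb_or -!leqNgt => /andP[ms nt].
  by split; apply/eqP; rewrite eqn_leq ?sm ?ms ?nt ?(dvdn_leq n0 tn).
split=> [|k u ks ut lt]; first by apply/perP; rewrite ?leqnn ?dvdnn.
have u0 := dvdn_gt0 t0 ut.
move=> /(perP _ _ u0)/andP[sk tu]; move: lt.
by rewrite !ltnNge sk (dvdn_leq u0 tu).
Qed.

Lemma has_period_finite_orbit (A : nzRingType) (f : {poly A}) m n z :
  (0 < n)%N -> has_period f m n z ->
  finite_set (range (fun i => iterate f i z)).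
Proof.
move=> n0 per; pose s := [seq iterate f i z | i <- iota 0 (m + n)].
apply: (@sub_finite_set _ _ [set` s]%classic); last exact: finite_seq.
move=> _ [i _ <-] /=; elim/ltn_ind: i => i IH.
have [lt|le] := ltnP i (m + n); first by apply: map_f; rewrite mem_iota.
have -> : iterate f i z = iterate f (i - n) z.
  have le' : (m <= i - n)%N.
    by rewrite leq_subRL 1?addnC // (leq_trans _ le) ?leq_addl.
  rewrite -[in LHS](subnK (leq_trans (leq_addl m n) le)).
  exact: iter_period_le le' per.
by apply: IH; rewrite ltn_subrL n0 (leq_trans _ le) // ltn_addl.
Qed.

Lemma unicritical_PCF (F : numFieldType) (d m n : nat) (c : F) :
  (2 <= d)%N -> (0 < n)%N -> has_period (unicritical d c) m n 0 ->
  PCF (unicritical d c).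
Proof.
move=> d2 n0 per z.
rewrite /unicritical derivD derivC addr0 derivXn rootE hornerMn hornerXn.
rewrite mulrn_eq0 expf_eq0 -subn1 subn_gt0 d2 gtn_eqF ?(ltnW d2) //=.
by move=> /eqP->; apply: has_period_finite_orbit n0 per.
Qed.

(** * Integrality and transversality *)

Local Notation integral := (integralOver intr).

Lemma integral_exp (K : fieldType) (x : K) n : integral x -> integral (x ^+ n).
Proof.
move=> ix; elim: n => [|n IH]; first exact: integral1.
by rewrite exprS; apply: integral_mul.
Qed.

Lemma integral_sum (K : fieldType) (I : Type) (r : seq I) (P : pred I) (F : I -> K) :
  (forall i, P i -> integral (F i)) -> integral (\sum_(i <- r | P i) F i).
Proof.
move=> iF; apply: big_ind => //; first exact: integral0.
by move=> x y; apply: integral_add.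
Qed.

Lemma integral_prod (K : fieldType) (I : Type) (r : seq I) (P : pred I) (F : I -> K) :
  (forall i, P i -> integral (F i)) -> integral (\prod_(i <- r | P i) F i).
Proof.
move=> iF; apply: big_ind => //; first exact: integral1.
by move=> x y; apply: integral_mul.
Qed.

(** An integer n >= 2 is not invertible among the algebraic integers: clearing
    denominators in an integral equation for 1 / n shows that n divides 1. *)
Lemma natr_mul_integral_neq1 (K : numFieldType) (n : nat) (x : K) :
  (2 <= n)%N -> integral x -> n%:R * x != 1.
Proof.
move=> n2 [p pmon /rootP px]; apply/eqP => nx.
have e : (\sum_(i < size p) p`_i * n%:R ^+ ((size p).-1 - i))%:~R = 0 :> K.
  rewrite -[RHS](mulr0 (n%:R ^+ (size p).-1)) -[in RHS]px horner_coef.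
  rewrite size_map_inj_poly //; last first.
    by apply: intr_inj.
  rewrite rmorph_sum mulr_sumr; apply: eq_bigr => i _.
  rewrite coef_map /= rmorphM rmorphXn /= mulrCA; congr (_ * _).
  rewrite -[in RHS](@subnK i (size p).-1); last by rewrite -ltnS (ltn_predK (ltn_ord i)).
  by rewrite exprD -mulrA -exprMn nx expr1n mulr1 rmorph_nat.
move/eqP: e; rewrite intr_eq0 => /eqP; have sp : (0 < size p)%N.
  by rewrite size_poly_gt0 monic_neq0.
rewrite -(prednK sp) big_ord_recr /= subnn mulr1.
have -> : p`_(size p).-1 = 1 by apply/eqP.
move=> e.
have : (n%:Z %| 1%R)%Z.
  move/eqP: e; rewrite addrC addr_eq0 => /eqP->; rewrite rpredN.
  apply: rpred_sum => i _; apply: dvdz_mull.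
  rewrite -(prednK (_ : 0 < (size p).-1 - i)%N) ?subn_gt0 // exprS.
  by rewrite natz dvdz_mulr.
by rewrite dvdz1 absz_nat => /eqP n1; rewrite n1 in n2.
Qed.

Definition orbit_poly (A : nzRingType) (d k : nat) : {poly A} :=
  iterate (unicritical d 'X) k 0.
Arguments orbit_poly : simpl never.

Lemma orbit_polyS (A : nzRingType) (d k : nat) :
  orbit_poly A d k.+1 = orbit_poly A d k ^+ d + 'X.
Proof. by rewrite /orbit_poly /iterate iterS unicritical_horner. Qed.

Lemma horner_orbit_poly (A : comNzRingType) (d k : nat) (c : A) :
  (orbit_poly A d k).[c] = iterate (unicritical d c) k 0.
Proof.
elim: k => [|k IH]; first by rewrite horner0.
rewrite orbit_polyS hornerD hornerX horner_exp IH.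
by rewrite /iterate iterS unicritical_horner.
Qed.

Lemma map_orbit_poly (A B : comNzRingType) (f : {rmorphism A -> B}) (d k : nat) :
  map_poly f (orbit_poly A d k) = orbit_poly B d k.
Proof.
elim: k => [|k IH]; first by rewrite rmorph0.
by rewrite !orbit_polyS rmorphD rmorphXn /= map_polyX IH.
Qed.

Lemma deriv_orbit_polyS (A : comNzRingType) (d k : nat) :
  (orbit_poly A d k.+1)^`() =
  (orbit_poly A d k ^+ d.-1 * (orbit_poly A d k)^`()) *+ d + 1.
Proof. by rewrite orbit_polyS derivD derivX deriv_exp mulrC. Qed.

Lemma orbit_poly_monic (A : idomainType) (d k : nat) : (2 <= d)%N ->
  orbit_poly A d k.+1 \is monic /\ size (orbit_poly A d k.+1) = (d ^ k).+1.
Proof.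
move=> d2; elim: k => [|k [mon sz]].
  rewrite orbit_polyS /orbit_poly /= expr0n gtn_eqF ?(ltnW d2) // add0r.
  by rewrite monicX size_polyX.
have szd : size (orbit_poly A d k.+1 ^+ d) = (d ^ k.+1).+1.
  by rewrite polySpred ?size_exp ?sz ?expnSr // expf_neq0 // monic_neq0.
have sX : (size ('X : {poly A}) < size (orbit_poly A d k.+1 ^+ d))%N.
  rewrite szd size_polyX ltnS.
  by rewrite (leq_trans d2) // -{1}(expn1 d) leq_pexp2l // ltnW.
rewrite orbit_polyS size_polyDl // monicE lead_coefDl // -monicE monic_exp //.
Qed.

(** The difference of two iterates of 0 is a monic polynomial in c with integer
    coefficients. *)
Lemma preperiodic_parameter_integral (K : numFieldType) (d m k : nat) (c : K) :
  (2 <= d)%N -> (0 < k)%N ->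
  (orbit_poly K d (m + k)).[c] = (orbit_poly K d m).[c] -> integral c.
Proof.
move=> d2; case: k => // k _; rewrite addnS => e.
have lt : (size (orbit_poly int d m) < size (orbit_poly int d (m + k).+1))%N.
  have [_ ->] := orbit_poly_monic int (m + k) d2.
  case: m e => [|m] e; first by rewrite size_poly0.
  have [_ ->] := orbit_poly_monic int m d2.
  by rewrite ltnS ltn_exp2l // addSn ltnS leq_addr.
exists (orbit_poly int d (m + k).+1 - orbit_poly int d m).
  rewrite monicE lead_coefDl ?size_polyN // -monicE.
  by case: (orbit_poly_monic int (m + k) d2).
by rewrite rmorphB /= !map_orbit_poly rootE hornerD hornerN e subrr.
Qed.

Lemma integral_orbit (K : fieldType) (d k : nat) (c : K) :
  integral c -> integral (orbit_poly K d k).[c].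
Proof.
move=> ic; elim: k => [|k IH]; first by rewrite horner0; apply: integral0.
rewrite orbit_polyS hornerD horner_exp hornerX.
by apply: integral_add => //; apply: integral_exp.
Qed.

Lemma integral_deriv_orbit (K : fieldType) (d k : nat) (c : K) :
  integral c -> integral (orbit_poly K d k)^`().[c].
Proof.
move=> ic; elim: k => [|k IH]; first by rewrite derivC horner0; apply: integral0.
rewrite deriv_orbit_polyS hornerD hornerC hornerMn hornerM horner_exp -mulr_natl.
apply: integral_add (integral1 _); apply: integral_mul (integral_nat _ _) _.
by apply: integral_mul IH; apply: integral_exp; apply: integral_orbit.
Qed.

(** Gleason's argument: the derivative of P^d + c is congruent to 1 modulo d,
    hence nonzero at an algebraic integer. *)
Lemma orbit_poly_simple_root (K : numFieldType) (d k : nat) (c : K) :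
  (2 <= d)%N -> (0 < k)%N -> root (orbit_poly K d k) c ->
  (orbit_poly K d k)^`().[c] != 0.
Proof.
move=> d2 k0 /rootP r; have ic : integral c.
  by apply: (@preperiodic_parameter_integral K d 0 k) => //; rewrite add0n r horner0.
case: k k0 r => // k _ _.
rewrite deriv_orbit_polyS hornerD hornerC hornerMn hornerM -mulr_natl horner_exp.
set b := _ ^+ _ * _; rewrite addr_eq0 -eqr_opp opprK -mulrN eq_sym.
rewrite eq_sym natr_mul_integral_neq1 //; apply: integral_opp.
apply: integral_mul (integral_deriv_orbit _ _ ic).
by apply: integral_exp; apply: integral_orbit.
Qed.

Lemma prod_one_sub_primitive_root (F : fieldType) (o : nat) (z : F) :
  o.-primitive_root z -> \prod_(1 <= i < o) (1 - z ^+ i) = o%:R.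
Proof.
move=> zo; have o0 := prim_order_gt0 zo.
have := factor_Xn_sub_1 zo; rewrite big_ltn // expr0 subrX1.
move=> /(mulfI (negbT (polyXsubC_eq0 1))) /(congr1 (horner^~ 1)).
rewrite horner_prod horner_sum => e.
under eq_bigr do rewrite -hornerXsubC.
rewrite e; under eq_bigr do rewrite hornerXn expr1n.
by rewrite sumr_const card_ord.
Qed.

(** Let o > 1 be the order of z. Each 1 - z^i is a multiple of 1 - z, hence of
    d, so their product o, for 0 < i < o, is a multiple of d^(o-1). As o
    divides d, this leaves only o = d = 2. *)
Lemma unity_root_congr1 (K : numFieldType) (d : nat) (z b : K) :
  (2 <= d)%N -> z ^+ d = 1 -> z != 1 -> integral b -> 1 - z = d%:R * b ->
  d = 2.
Proof.
move=> d2 zd z1 ib e.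
have [o zo /dvdnP[k dko]] := prim_order_exists (ltnW d2) zd.
have iz : integral z.
  have -> : z = 1 - d%:R * b by rewrite -e subKr.
  apply: integral_sub (integral1 _) _.
  by apply: integral_mul ib; apply: integral_nat.
have o2 : (2 <= o)%N.
  rewrite ltn_neqAle eq_sym (prim_order_gt0 zo) andbT.
  by apply: contraNneq z1 => o1; move: (prim_expr_order zo); rewrite o1 expr1 => ->.
(* the quotient of the product of the 1 - z ^+ i by d ^ (o - 1) *)
pose B := \prod_(1 <= i < o) (b * \sum_(j < i) z ^+ j).
have iB : integral B.
  apply: integral_prod => i _; apply: integral_mul ib _.
  by apply: integral_sum => j _; apply: integral_exp.
have k0 : (0 < k)%N by case: k dko d2 => // ->.
have eB : (d ^ (o - 2) * k)%:R * B = 1.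
  have o0 : o%:R != 0 :> K by rewrite pnatr_eq0 -lt0n (prim_order_gt0 zo).
  apply: (mulfI o0); rewrite mulr1 -[RHS](prod_one_sub_primitive_root zo).
  have -> : \prod_(1 <= i < o) (1 - z ^+ i) = d%:R ^+ (o - 1) * B.
    rewrite -[X in _ ^+ X]card_ord -prodr_const /B (big_addn 0 o 1%N).
    rewrite (big_addn 0 o 1%N) !big_mkord -big_split /=; apply: eq_bigr => i _.
    by rewrite mulrA -e -[1 - z]opprB mulNr -subrX1 opprB.
  rewrite mulrA -natrM -natrX; congr (_%:R * _).
  by rewrite mulnCA [(o * k)%N]mulnC -dko -expnSr -subSn.
have := contraL (fun N2 => natr_mul_integral_neq1 N2 iB) (introT eqP eB).
rewrite -ltnNge ltnS => le1.
have d0 : (0 < d ^ (o - 2))%N by rewrite expn_gt0 (ltnW d2).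
have k1 : (k <= 1)%N by apply: leq_trans le1; rewrite leq_pmull.
have o2' : (o <= 2)%N.
  rewrite -subn_eq0 -leqn0 -ltnS -(ltn_exp2l _ _ d2) expn1.
  by rewrite (leq_trans _ d2) // ltnS (leq_trans _ le1) // leq_pmulr.
rewrite dko; have -> : k = 1%N by apply/eqP; rewrite eqn_leq k1.
by rewrite mul1n; apply/eqP; rewrite eqn_leq o2 o2'.
Qed.

(** Reduces an equation that is a consequence of a known one to an identity
    that ring can check. *)
Lemma eq_of_subr_eq (V : zmodType) (a b a' b' : V) :
  a' = b' -> a - b = a' - b' -> a = b.
Proof. by move=> -> /eqP; rewrite subrr subr_eq0 => /eqP. Qed.

(** In a strictly preperiodic orbit, the last point before the cycle and the
    point of the cycle with the same image differ by such a factor z. If the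
    two derivatives agreed, then 1 - z would be d times an algebraic integer,
    since derivatives of iterates are congruent to 1 modulo d; so d = 2 and
    z = -1. In that case the congruence has to be refined: dividing by 2 gives
    x + y = -1 modulo 2, where x and y are the preceding iterates, whereas
    x^2 + c = - (y^2 + c) shows that (x + y)^2 = 0 modulo 2. *)
Lemma misiurewicz_transversality (K : numFieldType) (d M N : nat) (c z : K) :
  (2 <= d)%N -> (M < N)%N -> z ^+ d = 1 -> z != 1 ->
  (orbit_poly K d N.+1).[c] = z * (orbit_poly K d M.+1).[c] ->
  (orbit_poly K d N.+1)^`().[c] != z * (orbit_poly K d M.+1)^`().[c].
Proof.
move=> d2 MN zd z1 eNM; have ic : integral c.
  apply: (@preperiodic_parameter_integral K d M.+2 (N - M)) => //.
    by rewrite subn_gt0.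
  rewrite !addSn subnKC ?(ltnW MN) // !(orbit_polyS _ _ _.+1) !hornerD.
  by rewrite !horner_exp eNM exprMn zd mul1r.
have idz : integral z.
  exists ('X^d - 1); first by rewrite monicXnsubC // ltnW.
  by rewrite rmorphB /= map_polyXn rmorph1 rootE !hornerE zd subrr.
rewrite !deriv_orbit_polyS !hornerD !hornerC !hornerMn !hornerM !horner_exp.
set x := (orbit_poly K d N).[c]; set y := (orbit_poly K d M).[c].
set x' := (orbit_poly K d N)^`().[c]; set y' := (orbit_poly K d M)^`().[c].
have ix : integral x by apply: integral_orbit.
have iy : integral y by apply: integral_orbit.
have ix' : integral x' by apply: integral_deriv_orbit.
have iy' : integral y' by apply: integral_deriv_orbit.
apply/eqP; rewrite -[X in X + 1]mulr_natl -[X in z * (X + 1)]mulr_natl mulrDr mulr1 => e.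
have e1 : 1 - z = d%:R * (z * (y ^+ d.-1 * y') - x ^+ d.-1 * x').
  by move: e; move: (_ * x') (_ * y') => A C e; apply: (eq_of_subr_eq e); ring.
have dd : d = 2.
  apply: (unity_root_congr1 d2 zd z1 _ e1); apply: integral_sub.
    by do 2!apply: integral_mul => //; apply: integral_exp.
  by apply: integral_mul => //; apply: integral_exp.
have zN : z = -1.
  by move/eqP: zd; rewrite dd sqrf_eq1 (negPf z1) => /eqP.
have congr_x : exists2 u, integral u & x' = 1 + 2 * u.
  rewrite /x'; case: (N) MN => // N' _.
  rewrite deriv_orbit_polyS hornerD hornerC hornerMn hornerM horner_exp addrC.
  rewrite -mulr_natl dd; eexists; last reflexivity.
  apply: integral_mul; last exact: integral_deriv_orbit.
  by apply: integral_exp; apply: integral_orbit.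
have congr_y : exists2 v, integral v & y * y' = y + 2 * v.
  rewrite /y /y'; case: (M) => [|M'].
    by exists 0; [apply: integral0 | rewrite /orbit_poly /= horner0 !Monoid.simpm].
  rewrite deriv_orbit_polyS hornerD hornerC hornerMn hornerM horner_exp.
  rewrite mulrDr mulr1 addrC -mulr_natl dd mulrCA; eexists; last reflexivity.
  apply: integral_mul; first exact: integral_orbit.
  apply: integral_mul; last exact: integral_deriv_orbit.
  by apply: integral_exp; apply: integral_orbit.
have [[u iu eu] [v iv ev]] := (congr_x, congr_y).
have sq : x ^+ 2 + y ^+ 2 = - 2 * c.
  move: eNM; rewrite !orbit_polyS !hornerD !horner_exp !hornerX -/x -/y zN dd.
  by move=> h; apply: (eq_of_subr_eq h); ring.
pose w := v + x * u.
have sum : x + y = - 1 - 2 * w.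
  apply: (@mulfI _ 2); first by rewrite pnatr_eq0.
  move: e1; rewrite zN dd /= !expr1 ev eu /w => h.
  apply: (eq_of_subr_eq h); ring.
have iw : integral w by apply: integral_add => //; apply: integral_mul.
have two (w' : K) : integral w' -> integral (2%:R * w').
  by apply: integral_mul; apply: integral_nat.
have ib : integral (x * y - c - 2%:R * w - 2%:R * w ^+ 2).
  apply: integral_sub; last exact/two/integral_exp.
  apply: integral_sub; last exact/two.
  by apply: integral_sub => //; apply: integral_mul.
have /eqP := natr_mul_integral_neq1 (isT : 2 <= 2)%N ib; apply.
have h : (- 1 - 2 * w) ^+ 2 - 2 * x * y = - 2 * c by rewrite -sum -sq; ring.
by apply: (eq_of_subr_eq (esym h)); ring.
Qed.

(** * Orders of vanishing of differences of iterates *)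

Lemma horner_cofactor_XsubC (F : fieldType) (p : {poly F}) (a : F) :
  (p * ('X - a%:P))^`().[a] = p.[a].
Proof.
rewrite derivM derivXsubC mulr1 hornerD hornerM hornerXsubC.
by rewrite subrr mulr0 add0r.
Qed.

Lemma mup_simple_root (F : fieldType) (p : {poly F}) (a : F) :
  root p a -> p^`().[a] != 0 -> mup a p = 1%N.
Proof.
move=> pa dpa; have p0 : p != 0.
  by apply: contraNneq dpa => ->; rewrite derivC horner0.
apply/eqP; rewrite eqn_leq mup_leq // mup_geq // expr1 dvdp_XsubCl pa andbT.
apply: contraNN dpa => /dvdpP[q ->].
by rewrite expr2 mulrA horner_cofactor_XsubC hornerM hornerXsubC subrr mulr0.
Qed.

Lemma horner_subrXX_cofactor (R : comNzRingType) (p q : {poly R}) (a : R) n :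
  p.[a] = q.[a] ->
  (\sum_(i < n) p ^+ (n.-1 - i) * q ^+ i).[a] = q.[a] ^+ n.-1 *+ n.
Proof.
case: n => [_|n pq]; first by rewrite big_ord0 horner0.
rewrite horner_sum (eq_bigr (fun=> q.[a] ^+ n)) => [|i _].
  by rewrite sumr_const card_ord.
by rewrite hornerM !horner_exp pq -exprD subnK // -ltnS.
Qed.

Section Multiplicity.
Variables (K : numFieldType) (d : nat).
Hypothesis d2 : (2 <= d)%N.

Local Notation P := (orbit_poly K d).

Definition orbit_diff m k := orbit_poly K d (m + k) - orbit_poly K d m.

Lemma orbit_diff_neq0 m k : (0 < k)%N -> orbit_diff m k != 0.
Proof.
move=> k0; rewrite subr_eq0; apply/eqP => /(iterate_unicritical0_inj d2)/eqP.
by rewrite -{2}[m]addn0 eqn_add2l gtn_eqF.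
Qed.

Lemma root_orbit_diff m k a :
  root (orbit_diff m k) a = ((P (m + k)).[a] == (P m).[a]).
Proof. by rewrite rootE hornerD hornerN subr_eq0. Qed.

(** The second factor of X^d - Y^d = (X - Y) (X^(d-1) + ... + Y^(d-1)). *)
Definition diff_cofactor m k := \sum_(i < d) P (m + k) ^+ (d.-1 - i) * P m ^+ i.

Lemma orbit_diffS m k : orbit_diff m.+1 k = orbit_diff m k * diff_cofactor m k.
Proof.
rewrite /orbit_diff addSn !orbit_polyS opprD addrACA subrr addr0.
by rewrite subrXX.
Qed.

Lemma mup_orbit_diffS_regular m k a : (0 < k)%N ->
  (P m).[a] != 0 -> (P (m + k)).[a] = (P m).[a] ->
  mup a (orbit_diff m.+1 k) = mup a (orbit_diff m k).
Proof.
move=> k0 y0 xy; rewrite orbit_diffS mupMl // rootE.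
by rewrite horner_subrXX_cofactor // mulrn_eq0 negb_or -lt0n (ltnW d2) expf_neq0.
Qed.

Section AtParameter.
Variables (a : K) (s t : nat).
Hypothesis type : orbit_type (horner (unicritical d a)) 0 s t.

Lemma orbit_poly_eq m k : (0 < k)%N ->
  ((P (m + k)).[a] == (P m).[a]) = (s <= m)%N && (t %| k)%N.
Proof. by case: type => _ type' k0; rewrite !horner_orbit_poly type'. Qed.

Lemma root_orbit_poly m : s = 0%N -> root (P m) a = (t %| m)%N.
Proof.
move=> s0; case: m => [|m]; first by rewrite dvdn0 rootE horner0 eqxx.
have := @orbit_poly_eq 0 m.+1 isT; rewrite s0 add0n leq0n andTb => <-.
by rewrite [(P 0).[a]]horner0.
Qed.

(** When 0 is periodic, P_j vanishes at a for j a multiple of the period, so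
    the term d P_j^(d-1) P_j' of the derivative of P_(j+1) vanishes too and the
    recursion for the derivatives starts afresh. *)
Lemma deriv_orbit_poly_shift j i : s = 0%N -> (t %| j)%N ->
  (P (j + i.+1))^`().[a] = (P i.+1)^`().[a].
Proof.
move=> s0 tj; elim: i => [|i IH].
  rewrite addn1 !deriv_orbit_polyS !hornerD !hornerMn !hornerM.
  have /rootP Pj : root (P j) a by rewrite root_orbit_poly.
  rewrite !horner_exp Pj horner0 expr0n -subn1 subn_eq0 leqNgt d2 /=.
  by rewrite !mul0r.
rewrite addnS (deriv_orbit_polyS _ _ (j + i.+1)) (deriv_orbit_polyS _ _ i.+1).
rewrite !hornerD !hornerMn !hornerM !horner_exp IH.
suff -> : (P (j + i.+1)).[a] = (P i.+1).[a] by [].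
case: j tj {IH} => // j tj; apply/eqP; rewrite addnC orbit_poly_eq // tj s0.
by [].
Qed.

Lemma deriv_orbit_poly_periodic j l : s = 0%N -> (t %| j)%N -> (t %| l)%N ->
  (0 < j)%N -> (0 < l)%N -> (P j)^`().[a] = (P l)^`().[a].
Proof.
move=> s0; case: type => t0 _.
suff step i : (t %| i)%N -> (0 < i)%N -> (P i)^`().[a] = (P t)^`().[a].
  by move=> tj tl j0 l0; rewrite !step.
move=> ti i0; have le := dvdn_leq i0 ti.
rewrite -[in LHS](subnK le) -(prednK t0); apply: deriv_orbit_poly_shift => //.
by rewrite prednK // dvdn_subr.
Qed.

(** Both P_(m+k) and P_m have a simple zero at a, with the same derivative, so
    the d terms of the cofactor have order d - 1 and equal leading
    coefficients, which do not cancel. For m = 0 only one term remains. *)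
Lemma mup_diff_cofactor_critical m k : s = 0%N -> (0 < k)%N -> (t %| m)%N ->
  (t %| k)%N -> mup a (diff_cofactor m k) = d.-1.
Proof.
move=> s0 k0 tm tk.
have tmk : (t %| m + k)%N by rewrite dvdn_add.
have mk0 : (0 < m + k)%N by rewrite addn_gt0 k0 orbT.
have /factor_theorem[X eX] : root (P (m + k)) a by rewrite root_orbit_poly.
have /factor_theorem[Y eY] : root (P m) a by rewrite root_orbit_poly.
have Xa : X.[a] != 0.
  rewrite -horner_cofactor_XsubC -eX orbit_poly_simple_root //.
  by rewrite root_orbit_poly.
rewrite /diff_cofactor eX eY.
have -> : \sum_(i < d) (X * ('X - a%:P)) ^+ (d.-1 - i) * (Y * ('X - a%:P)) ^+ i =
    (\sum_(i < d) X ^+ (d.-1 - i) * Y ^+ i) * ('X - a%:P) ^+ d.-1.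
  rewrite mulr_suml; apply: eq_bigr => i _; rewrite !exprMn mulrACA -exprD.
  by rewrite subnK // -ltnS (ltn_predK d2).
rewrite mupMr; first by rewrite mup_XsubCX eqxx.
rewrite rootE; have [m0|m0] := posnP m.
  have Ya : Y = 0.
    apply/eqP; move/eqP: eY; rewrite m0 /orbit_poly /= eq_sym mulf_eq0.
    by rewrite polyXsubC_eq0 orbF.
  have d0 := ltnW d2; rewrite -(prednK d0) horner_sum big_ord_recl /= subn0 mulr1 big1.
    by rewrite addr0 horner_exp expf_neq0.
  by move=> i _; rewrite Ya expr0n mulr0 horner0.
have XY : Y.[a] = X.[a].
  rewrite -(horner_cofactor_XsubC Y) -(horner_cofactor_XsubC X) -eX -eY.
  by apply: deriv_orbit_poly_periodic.
by rewrite horner_subrXX_cofactor // XY mulrn_eq0 negb_or -lt0n (ltnW d2) expf_neq0.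
Qed.

Lemma mup_orbit_diff0 k : s = 0%N -> (0 < k)%N ->
  mup a (orbit_diff 0 k) = (t %| k)%N.
Proof.
move=> s0 k0; rewrite /orbit_diff add0n [P 0]/orbit_poly /= subr0.
case: (boolP (t %| k)%N); rewrite -root_orbit_poly // => r.
  by rewrite mup_simple_root // orbit_poly_simple_root.
by rewrite mupNroot.
Qed.

(** When 0 is periodic, only the passages through the critical point change the
    order. The excess d - 1 is what the denominator of G removes. *)
Lemma mup_orbit_diffS m k : s = 0%N -> (0 < k)%N ->
  mup a (orbit_diff m.+1 k) =
  (mup a (orbit_diff m k) + d.-1 * ((t %| m) * (t %| k)))%N.
Proof.
move=> s0 k0; have [tk|ntk] := boolP (t %| k)%N; last first.
  by rewrite !mupNroot ?muln0 // root_orbit_diff orbit_poly_eq // (negPf ntk) andbF.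
have [tm|ntm] := boolP (t %| m)%N; rewrite ?muln1 ?muln0 ?addn0.
  rewrite orbit_diffS mupM ?mup_diff_cofactor_critical ?orbit_diff_neq0 //.
  by have := orbit_diff_neq0 m.+1 k0; rewrite orbit_diffS mulf_eq0 negb_or => /andP[].
apply: mup_orbit_diffS_regular => //.
  by rewrite -rootE root_orbit_poly.
by apply/eqP; rewrite orbit_poly_eq // s0 tk.
Qed.

(** The zero appears when m reaches the preperiod s, where it is simple by
    transversality; afterwards the orbit avoids 0 and the order does not
    change. *)
Lemma mup_orbit_diff_preperiodic m k : (0 < s)%N -> (0 < k)%N ->
  mup a (orbit_diff m k) = ((s <= m) * (t %| k))%N.
Proof.
move=> s0 k0; have [/andP[sm tk]|nr] := boolP ((s <= m) && (t %| k))%N; last first.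
  by rewrite mupNroot ?root_orbit_diff ?orbit_poly_eq // mulnb (negPf nr).
rewrite sm tk /=.
have P_neq0 i : (0 < i)%N -> (P i).[a] != 0.
  move=> i0; have := @orbit_poly_eq 0 i i0; rewrite leqNgt s0 /= => /negbT.
  by rewrite [X in _ == X]horner0.
rewrite -(subnK sm); elim: (m - s)%N => [|i IH]; last first.
  rewrite mup_orbit_diffS_regular // ?P_neq0 ?addn_gt0 ?s0 ?orbT //.
  by apply/eqP; rewrite orbit_poly_eq // leq_addl.
rewrite add0n; apply: mup_simple_root.
  by rewrite root_orbit_diff orbit_poly_eq // leqnn.
have eS : (P (s + k)).[a] = (P s).[a] by apply/eqP; rewrite orbit_poly_eq ?leqnn.
have Peq := orbit_poly_eq; have [s' es] : exists s', s = s'.+1.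
  by exists s.-1; rewrite prednK.
rewrite es {sm s0} in eS Peq *.
have xy : (P (s' + k)).[a] != (P s').[a] by rewrite Peq // ltnn.
case: s' {es} eS Peq xy => [|M] eS Peq xy.
  move: eS xy; rewrite add1n add0n !orbit_polyS !hornerD !horner_exp => /addIr.
  rewrite horner0 expr0n gtn_eqF ?(ltnW d2) // => /eqP.
  by rewrite expf_eq0 => /andP[_ ->].
rewrite /orbit_diff !addSn in eS xy *.
set x := (P (M + k).+1).[a] in xy; set y := (P M.+1).[a] in xy.
have y0 : y != 0 by apply: P_neq0.
have xdyd : x ^+ d = y ^+ d.
  by move: eS; rewrite !(orbit_polyS _ _ _.+1) !hornerD !horner_exp => /addIr.
pose z := x / y.
have xz : x = z * y by rewrite divfK.
have zd : z ^+ d = 1 by rewrite expr_div_n xdyd divff ?expf_neq0.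
have z1 : z != 1 by apply: contraNneq xy => z1; rewrite xz z1 mul1r.
have lt : (M < M + k)%N by rewrite -{1}[M]addn0 ltn_add2l.
have := misiurewicz_transversality d2 lt zd z1 xz.
rewrite derivD derivN hornerD hornerN subr_eq0.
apply: contraNN; rewrite !(deriv_orbit_polyS _ _ _.+1) !hornerD !hornerMn !hornerM.
rewrite !horner_exp -/x -/y => /eqP/addIr; rewrite xz exprMn.
move: (P (M + k).+1)^`().[a] (P M.+1)^`().[a] => x' y' /eqP.
rewrite eqrMn2r gtn_eqF ?(ltnW d2) //= -mulrA mulrCA.
move=> /eqP/(mulfI (expf_neq0 _ y0)) <-.
by rewrite mulrA -exprS prednK ?(ltnW d2) // zd mul1r.
Qed.

End AtParameter.
End Multiplicity.

(** * Divisors of rational functions *)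

Local Notation tofrac := FracField.tofrac.

(** A single fraction A / B serves for all points, so that cancelling B against
    A yields a polynomial as soon as v is nonnegative. *)
Definition has_divisor (F : fieldType) (f : {fraction {poly F}}) (v : F -> int) :=
  exists A B : {poly F}, [/\ A != 0, B != 0, f = tofrac A / tofrac B
    & forall x, v x = (mup x A)%:Z - (mup x B)%:Z].

Section Divisors.
Variable F : fieldType.
Implicit Types (f g : {fraction {poly F}}) (v w : F -> int).

Lemma has_divisor_poly (A : {poly F}) : A != 0 ->
  has_divisor (tofrac A) (fun x => (mup x A)%:Z).
Proof.
move=> A0; exists A, 1; split; rewrite ?oner_neq0 ?tofrac1 ?divr1 // => x.
by rewrite [mup x 1]mupNroot ?subr0 // root1.
Qed.

Lemma has_divisorM f g v w : has_divisor f v -> has_divisor g w ->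
  has_divisor (f * g) (fun x => v x + w x).
Proof.
move=> [A [B [A0 B0 -> ev]]] [C [D [C0 D0 -> ew]]].
exists (A * C), (B * D); split; rewrite ?mulf_neq0 //.
  by rewrite !tofracM invfM mulrACA.
by move=> x; rewrite ev ew !mupM // !PoszD opprD addrACA.
Qed.

Lemma has_divisorV f v : has_divisor f v -> has_divisor f^-1 (fun x => - v x).
Proof.
move=> [A [B [A0 B0 -> ev]]]; exists B, A; split=> // [|x].
  by rewrite invfM invrK mulrC.
by rewrite ev opprB.
Qed.

Lemma has_divisor1 : has_divisor (1 : {fraction {poly F}}) (fun=> 0).
Proof.
exists 1, 1; split; rewrite ?oner_neq0 ?tofrac1 ?divr1 // => x; by rewrite subrr.
Qed.

Lemma has_divisor_ext f v w : v =1 w -> has_divisor f v -> has_divisor f w.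
Proof. by move=> vw [A [B [A0 B0 fAB ev]]]; exists A, B; split=> // x; rewrite -vw. Qed.

Lemma has_divisorX f v n : has_divisor f v ->
  has_divisor (f ^+ n) (fun x => v x * n%:Z).
Proof.
move=> fv; elim: n => [|n IH].
  by apply: has_divisor_ext has_divisor1 => x; rewrite mulr0.
rewrite exprS; apply: has_divisor_ext (has_divisorM fv IH) => x /=.
by rewrite intS mulrDr mulr1.
Qed.

Lemma has_divisorXz f v (n : int) : has_divisor f v ->
  has_divisor (f ^ n) (fun x => v x * n).
Proof.
move=> fv; case: n => n; first exact: has_divisorX.
apply: has_divisor_ext (has_divisorV (has_divisorX n.+1 fv)) => x.
by rewrite NegzE mulrN.
Qed.

Lemma has_divisor_prod (I : eqType) (r : seq I) (f : I -> {fraction {poly F}})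
    (v : I -> F -> int) : (forall i, i \in r -> has_divisor (f i) (v i)) ->
  has_divisor (\prod_(i <- r) f i) (fun x => \sum_(i <- r) v i x).
Proof.
elim: r => [|i r IH] fv.
  by rewrite big_nil; apply: has_divisor_ext has_divisor1 => x; rewrite big_nil.
rewrite big_cons; have IHr := IH (fun j jr => fv j (mem_behead (s := i :: r) jr)).
apply: has_divisor_ext (has_divisorM (fv i (mem_head _ _)) IHr) => x.
by rewrite big_cons.
Qed.
End Divisors.

Lemma dvdp_mup (F : closedFieldType) (A B : {poly F}) : A != 0 -> B != 0 ->
  (forall x, mup x B <= mup x A)%N -> B %| A.
Proof.
have [n] := ubnP (size B); elim: n => // n IH in A B *.
rewrite ltnS => szB A0 B0 le.
have [/size_poly1P[c c0 ->]|/closed_rootP[x xB]] := boolP (size B == 1%N).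
  by rewrite -alg_polyC dvdpZl // dvd1p.
have xA : root A x.
  rewrite -dvdp_XsubCl XsubC_dvd // (leq_trans _ (le x)) // -XsubC_dvd //.
  by rewrite dvdp_XsubCl.
case/factor_theorem: xB szB B0 le => B' -> szB B0 le.
case/factor_theorem: xA A0 le => A' -> A0 le.
have /andP[A'0 X0] : (A' != 0) && ('X - x%:P != 0) by rewrite -negb_or -mulf_eq0.
have B'0 : B' != 0 by move: B0; rewrite mulf_eq0 negb_or => /andP[].
apply: dvdp_mul => //; apply: IH => // [|y].
  by rewrite size_Mmonic ?monicXsubC // size_XsubC addn2 in szB.
by have := le y; rewrite !mupM // leq_add2r.
Qed.

Lemma effective_divisor (F : closedFieldType) (f : {fraction {poly F}}) (v : F -> int) :
  has_divisor f v -> (forall x, 0 <= v x) ->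
  exists2 g : {poly F}, g != 0 /\ tofrac g = f & forall x, (mup x g)%:Z = v x.
Proof.
move=> [A [B [A0 B0 -> ev]]] v0.
have /dvdpP[g eA] : B %| A.
  by apply: dvdp_mup => // x; have := v0 x; rewrite ev subr_ge0.
have g0 : g != 0 by apply: contraNneq A0 => g0; rewrite eA g0 mul0r.
exists g => [|x]; last by rewrite ev eA mupM // PoszD addrK.
by split=> //; rewrite eA tofracM mulfK // tofrac_eq0.
Qed.

(** * The divisor of G *)

Section DivisorOfG.
Variables (K : numClosedFieldType) (d n : nat).
Hypotheses (d2 : (2 <= d)%N) (n0 : (0 < n)%N).

Definition dynatomic_order (a : K) (m : nat) : int :=
  \sum_(k <- divisors n) (mup a (orbit_diff K d m k))%:Z * moebius (n %/ k).

Let f := generic_unicritical K d.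

Lemma has_divisor_dynatomic m :
  has_divisor (dynatomic f n (iterate f m 0)) (dynatomic_order^~ m).
Proof.
apply: has_divisor_prod => k; rewrite -dvdn_divisors // => kn.
apply: has_divisorXz; rewrite /iterate -iterD addnC -!/(iterate _ _ _).
rewrite !iterate_generic0 -tofracB; apply: has_divisor_poly.
exact: orbit_diff_neq0 (dvdn_gt0 n0 kn).
Qed.

Definition G_order (a : K) (m : nat) : int :=
  if m is m'.+1 then
    dynatomic_order a m - dynatomic_order a m'
      - (if (n %| m')%N then dynatomic_order a 0 * (d - 1)%N else 0)
  else dynatomic_order a 0.

Lemma has_divisor_G m : has_divisor (G K d m n) (G_order^~ m).
Proof.
case: m => [|m]; first exact: has_divisor_dynatomic 0%N.
have hd := has_divisorM (has_divisor_dynatomic m.+1)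
  (has_divisorV (has_divisor_dynatomic m)).
rewrite /G /G_order subn1 /=; case: ifP => _.
  exact: has_divisorM hd (has_divisorV (has_divisorX _ (has_divisor_dynatomic 0%N))).
by apply: has_divisor_ext hd => x; rewrite subr0.
Qed.

Lemma G_order_wandering a m :
  (forall m k, (0 < k)%N ->
     iter (m + k) (horner (unicritical d a)) 0 !=
     iter m (horner (unicritical d a)) 0) ->
  G_order a m = 0.
Proof.
move=> wand; have dyn0 i : dynatomic_order a i = 0.
  rewrite /dynatomic_order big1_seq // => k /andP[_]; rewrite -dvdn_divisors // => kn.
  rewrite mupNroot ?mul0r // root_orbit_diff !horner_orbit_poly.
  exact: wand (dvdn_gt0 n0 kn).
by case: m => [|m]; rewrite /G_order !dyn0 // mul0r if_same !subr0.
Qed.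

(** Summing over k against the Moebius function keeps only the parameters of
    period t = n. If s > 0 the dynatomic order is then 1 from m = s on, so its
    increment is 1 at m = s only. If s = 0 it starts from 1 and grows by d - 1
    after each multiple of n: for m > 0 this growth is exactly cancelled by
    the correcting denominator. *)
Lemma G_order_orbit_type a m s t :
  orbit_type (horner (unicritical d a)) 0 s t ->
  G_order a m = ((s == m) && (t == n))%:R.
Proof.
move=> type; have t0 : (0 < t)%N by case: type.
have k_gt0 k : k \in divisors n -> (0 < k)%N.
  by rewrite -dvdn_divisors // => /(dvdn_gt0 n0).
have sumE (c : nat) : \sum_(k <- divisors n) (c * (t %| k))%N%:Z * moebius (n %/ k)
    = c%:Z * (t == n)%:R.
  rewrite -(moebius_sum_multiples n0 t0) mulr_sumr; apply: eq_bigr => k _.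
  by rewrite PoszM -mulrA [_%:Z * moebius _]mulrC natz.
have [s0|s0] := posnP s; last first.
  have dynE i : dynatomic_order a i = ((s <= i)%N : nat)%:Z * (t == n)%:R.
    rewrite -sumE; apply: eq_big_seq => k /k_gt0 kgt0.
    by rewrite (mup_orbit_diff_preperiodic d2 type).
  have s_nle0 : (s <= 0)%N = false by rewrite leqNgt s0.
  rewrite /G_order; case: m => [|m]; rewrite !dynE s_nle0 !mul0r ?if_same.
    by rewrite gtn_eqF.
  rewrite leq_eqVlt ltnS; case: eqP => [->|_] /=; last by rewrite subrr subr0.
  by rewrite ltnn mul1r mul0r !subr0.
have dyn0 : dynatomic_order a 0 = (t == n)%:R.
  rewrite -[RHS]mul1r -(sumE 1%N); apply: eq_big_seq => k /k_gt0 kgt0.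
  by rewrite (mup_orbit_diff0 d2 type) // mul1n.
have dynS i : dynatomic_order a i.+1 =
    dynatomic_order a i + (d.-1 * (t %| i))%N%:Z * (t == n)%:R.
  rewrite -sumE -big_split /=; apply: eq_big_seq => k /k_gt0 kgt0.
  by rewrite (mup_orbit_diffS d2 type) // PoszD mulrDl mulnA.
rewrite /G_order s0; case: m => [|m] //=.
rewrite dynS [X in X - _]addrAC subrr add0r dyn0 subn1.
have [tn|_] := eqVneq t n; last by rewrite !mulr0 mul0r if_same subr0.
by rewrite tn mulr1; case: (n %| m)%N; rewrite ?muln1 ?muln0 ?mul1r ?subrr.
Qed.

End DivisorOfG.

Theorem theorem1p1 (R : realType) (d m n : nat) (hd : (2 <= d)%N)
    (hn : (1 <= n)%N) :
  exists g : {poly R[i]},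
    [/\ FracField.tofrac g = G R[i] d m n,
        (forall c : R[i],
           PCF (unicritical d c) /\ exact_period (unicritical d c) m n 0 <->
           root g c)
      & (forall c : R[i], root g c -> mup c g = 1%N)].
Proof.
have ord (c : R[i]) : G_order d n c m = 1 /\ exact_period (unicritical d c) m n 0 \/
    G_order d n c m = 0 /\ ~ exact_period (unicritical d c) m n 0.
  have [wand|[s [t type]]] := orbit_type_exists (horner (unicritical d c)) 0.
    right; split; first exact: G_order_wandering.
    by case=> /eqP per _; have := wand m n hn; rewrite per.
  have := exact_periodP m type hn; rewrite (G_order_orbit_type hd hn m type).
  case: eqP => [->|sm]; last by move=> per; right; split=> // /per[].
  case: eqP => [->|tn] per; first by left; split=> //; apply/per.
  by right; split=> // /per[].
have [|g [g0 eg] mupg] := effective_divisor (has_divisor_G R[i] hd hn m).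
  by move=> c; case: (ord c) => -[->].
have rootE c : root g c = (0 < mup c g)%N by rewrite -XsubC_dvd // dvdp_XsubCl.
exists g; split=> // c; rewrite rootE; last first.
  move=> mup0; apply/eqP; move: mup0; rewrite -eqz_nat mupg.
  by case: (ord c) (mupg c) => -[->] _ => // [[->]].
have := mupg c; case: (ord c) => -[-> per] [->]; last by split=> // -[].
split=> // _; split=> //; apply: unicritical_PCF hd hn _; exact: per.1.
Qed.
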